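(* For all $s > 0$, $$\theta_3''(s)\theta_3(s) - \theta_3'(s)^2 > -\frac{\theta_3'(s)\theta_3(s)}{s} > 0.$$
   Context: For $s>0$, $\theta_3(s) = \sum_{k\in\mathbb{Z}} e^{-\pi k^2 s}$. *)

(* Defs.v *)
From Stdlib Require Import Reals Lra ZArith ClassicalEpsilon.
Open Scope R_scope.

(* Symmetric partial sum  sum_{k = -n}^{n} exp(-pi k^2 s), indexed by j = k + n in 0..2n. *)
Definition theta3_partial (s : R) (n : nat) : R :=
  sum_f_R0 (fun j => exp (- PI * (IZR (Z.of_nat j - Z.of_nat n))^2 * s)) (2 * n).

(* theta_3(s) = sum_{k in Z} exp(-pi k^2 s): the limit of the symmetric partial sums
   (the series is absolutely convergent for s > 0, so this is the sum over Z). *)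
Definition theta3 (s : R) : R :=
  epsilon (inhabits 0) (fun l => Un_cv (theta3_partial s) l).

(* Main.v *)
Require Import Defs.
From Stdlib Require Import Reals Lra Lia Psatz ZArith ClassicalEpsilon.
From Coquelicot Require Import Coquelicot.
Open Scope R_scope.

(** The inequality says that the logarithmic slope [g s = s theta'(s) / theta(s)] has positive
    derivative.  For [s >= 1] the nome [q = exp (- PI s)] is at most [1/8] and crude bounds on
    the power series in [q] suffice.  The inversion formula [s theta(s)^2 = theta(1/s)^2]
    gives [g s = - 1/2 - g (1/s)], which carries the sign of [g'] from [1/s] to [s].

    The inversion formula is obtained by Polya's argument: expanding [cos^(2m)] in binomial
    weights and averaging over the angles [PI j / l], [|j| <= p], [l = 2p+1], gives
    [sum_j cos (PI j / l)^(2m) = l sum_k binomial (2m) (m + k l) / 4^m].  With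
    [m ~ s l^2 / PI] the left side tends to [theta s] and the right side to a multiple of
    [theta (1/s)], by dominated convergence; the case [s = 1] determines the constant,
    so Wallis' formula is not needed. *)

(** * Finite sums and elementary exponential bounds *)

Lemma sum_f_R0_ext (u v : nat -> R) (n : nat) :
  (forall k, u k = v k) -> sum_f_R0 u n = sum_f_R0 v n.
Proof. intros H. apply sum_eq. auto. Qed.

Lemma sum_f_R0_0 (u : nat -> R) : sum_f_R0 u 0 = u 0%nat.
Proof. reflexivity. Qed.

(** Skips a block of zeros. It serves twice: for frequencies between consecutive multiples of
    [2p+1], and for exponents between consecutive squares. *)
Lemma sum_f_R0_lacuna (u : nat -> R) (a d : nat) :
  (forall i, (a < i < a + S d)%nat -> u i = 0) ->
  sum_f_R0 u (a + S d) = sum_f_R0 u a + u (a + S d)%nat.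
Proof.
  intros H.
  assert (K : forall e, (e <= d)%nat -> sum_f_R0 u (a + e) = sum_f_R0 u a).
  { induction e as [|e IH]; intros He.
    - now rewrite Nat.add_0_r.
    - rewrite Nat.add_succ_r, tech5, IH by lia.
      rewrite H by lia. ring. }
  rewrite Nat.add_succ_r, tech5, K by lia. reflexivity.
Qed.

Lemma one_minus_le_exp (y : R) : 1 - y <= exp (- y).
Proof. generalize (exp_ineq1_le (- y)). lra. Qed.

(** Reciprocal of [1 + u <= exp u] at [u = y / (1 - y)], where [1 + u = 1 / (1 - y)]. *)
Lemma exp_le_one_minus (y : R) : y < 1 -> exp (- (y / (1 - y))) <= 1 - y.
Proof.
  intros H. rewrite exp_Ropp.
  replace (1 - y) with (/ (1 + y / (1 - y))) at 2 by (field; lra).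
  apply Rinv_le_contravar.
  - replace (1 + y / (1 - y)) with (/ (1 - y)) by (field; lra).
    apply Rinv_0_lt_compat; lra.
  - apply exp_ineq1_le.
Qed.

Lemma exp_le (x y : R) : x <= y -> exp x <= exp y.
Proof. intros [H| ->]; [apply Rlt_le, exp_increasing, H|apply Rle_refl]. Qed.

Lemma exp_pow (x : R) (n : nat) : exp x ^ n = exp (INR n * x).
Proof.
  induction n as [|n IH].
  - simpl. rewrite Rmult_0_l, exp_0. reflexivity.
  - rewrite S_INR, Rmult_plus_distr_r, exp_plus, Rmult_1_l, <- IH. simpl. ring.
Qed.

(** * Central binomial weights *)

(* [walk m v] is [binomial (2m) (m+v) / 4^m], defined by Pascal's rule applied twice. *)
Fixpoint walk (m v : nat) : R :=
  match m, v with
  | O, O => 1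
  | O, S _ => 0
  | S m, O => (walk m 0 + walk m 1) / 2
  | S m, S v => (walk m v + 2 * walk m (S v) + walk m (S (S v))) / 4
  end.

(** Ratio of adjacent binomial coefficients in row [2m]; the Gaussian estimates on [walk] below all
    come from it. *)
Lemma walk_ratio (m v : nat) :
  (INR m + INR v + 1) * walk m (S v) = (INR m - INR v) * walk m v.
Proof.
  revert v. induction m as [|m IH]; intros v.
  - destruct v; simpl; ring.
  - assert (pm := pos_INR m). assert (pv := pos_INR v).
    assert (R : forall v, walk m (S v) = (INR m - INR v) / (INR m + INR v + 1) * walk m v).
    { intros u. assert (pu := pos_INR u).
      apply Rmult_eq_reg_l with (INR m + INR u + 1); [|lra].
      rewrite IH. field. lra. }
    destruct v as [|v].
    + cbn [walk]. rewrite (R 1%nat), (R 0%nat), S_INR. simpl INR. field. lra.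
    + cbn [walk]. assert (pv' := pos_INR v).
      rewrite (R (S (S v))), (R (S v)), (R v), !S_INR. field. lra.
Qed.

Lemma walk_succ_0 (m : nat) :
  walk (S m) 0 = (2 * INR m + 1) / (2 * INR m + 2) * walk m 0.
Proof.
  assert (pm := pos_INR m). assert (H := walk_ratio m 0).
  simpl INR in H. cbn [walk].
  replace (walk m 1) with (INR m / (INR m + 1) * walk m 0).
  - field. lra.
  - apply Rmult_eq_reg_l with (INR m + 0 + 1); [|lra].
    rewrite H. field. lra.
Qed.

Lemma walk_0_pos (m : nat) : 0 < walk m 0.
Proof.
  induction m as [|m IH]; [simpl; lra|].
  rewrite walk_succ_0. assert (pm := pos_INR m).
  apply Rmult_lt_0_compat; [apply Rdiv_lt_0_compat|]; lra.
Qed.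

Lemma walk_outside (m v : nat) : (m < v)%nat -> walk m v = 0.
Proof.
  revert v. induction m as [|m IH]; intros [|v] H; try lia; [reflexivity|].
  cbn [walk]. rewrite !IH by lia. field.
Qed.

(** [walk m v / walk m 0] is the product over [u < v] of [1 - (2u+1)/(m+u+1)]. Each factor is at
    most [exp (- (2u+1)/(m+v))], and the odd numbers [2u+1] add up to [v^2]. *)
Lemma walk_upper (m v : nat) : (v <= m)%nat -> (0 < m)%nat ->
  0 <= walk m v <= walk m 0 * exp (- (INR v ^ 2 / (INR m + INR v))).
Proof.
  intros Hv Hm.
  assert (pm := lt_0_INR _ Hm).
  assert (W := walk_0_pos m).
  (* The denominator keeps the final [v] while [u] grows, so that the exponents add exactly:
     [u^2 + (2u+1) = (u+1)^2]. *)
  assert (K : forall u, (u <= v)%nat ->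
     0 <= walk m u <= walk m 0 * exp (- (INR u ^ 2 / (INR m + INR v)))).
  { assert (pv := pos_INR v).
    induction u as [|u IH]; intros Hu.
    - replace (- (INR 0 ^ 2 / (INR m + INR v))) with 0 by (simpl; field; lra).
      rewrite exp_0. lra.
    - destruct IH as [I1 I2]; [lia|].
      assert (pu := pos_INR u).
      assert (Huv : INR u + 1 <= INR v) by (rewrite <- S_INR; apply le_INR; lia).
      assert (Hvm : INR v <= INR m) by (apply le_INR; lia).
      replace (walk m (S u)) with (walk m u * (1 - (2 * INR u + 1) / (INR m + INR u + 1))).
      2:{ apply Rmult_eq_reg_l with (INR m + INR u + 1); [|lra].
          rewrite walk_ratio. field. lra. }
      set (y := (2 * INR u + 1) / (INR m + INR u + 1)).
      assert (y1 : y <= 1) by (apply Rle_div_l; lra).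
      assert (y2 : (2 * INR u + 1) / (INR m + INR v) <= y).
      { apply Rmult_le_compat_l; [lra|]. apply Rinv_le_contravar; lra. }
      split; [apply Rmult_le_pos; lra|].
      replace (- (INR (S u) ^ 2 / (INR m + INR v))) with
        (- (INR u ^ 2 / (INR m + INR v)) + - ((2 * INR u + 1) / (INR m + INR v)))
        by (rewrite S_INR; field; lra).
      rewrite exp_plus, <- Rmult_assoc.
      apply Rmult_le_compat; try lra.
      apply Rle_trans with (1 := one_minus_le_exp y).
      apply exp_le. lra. }
  apply K. lia.
Qed.

(** Same product as in [walk_upper], with each factor bounded below by [exp_le_one_minus]: here
    [y / (1 - y) = (2u+1)/(m-u)], and [m - u >= m - v + 1] for [u < v]. *)
Lemma walk_lower (m v : nat) : (v <= m)%nat ->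
  walk m 0 * exp (- (INR v ^ 2 / (INR m - INR v + 1))) <= walk m v.
Proof.
  intros Hv.
  assert (W := walk_0_pos m).
  assert (K : forall u, (u <= v)%nat ->
     walk m 0 * exp (- (INR u ^ 2 / (INR m - INR v + 1))) <= walk m u).
  { assert (pv := pos_INR v).
    assert (Hvm : INR v <= INR m) by (apply le_INR; lia).
    induction u as [|u IH]; intros Hu.
    - replace (- (INR 0 ^ 2 / (INR m - INR v + 1))) with 0 by (simpl; field; lra).
      rewrite exp_0. lra.
    - specialize (IH ltac:(lia)).
      assert (pu := pos_INR u).
      assert (Huv : INR u + 1 <= INR v) by (rewrite <- S_INR; apply le_INR; lia).
      replace (walk m (S u)) with (walk m u * (1 - (2 * INR u + 1) / (INR m + INR u + 1))).
      2:{ apply Rmult_eq_reg_l with (INR m + INR u + 1); [|lra].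
          rewrite walk_ratio. field. lra. }
      set (y := (2 * INR u + 1) / (INR m + INR u + 1)).
      assert (y1 : y < 1) by (apply Rlt_div_l; lra).
      replace (- (INR (S u) ^ 2 / (INR m - INR v + 1))) with
        (- (INR u ^ 2 / (INR m - INR v + 1)) + - ((2 * INR u + 1) / (INR m - INR v + 1)))
        by (rewrite S_INR; field; lra).
      rewrite exp_plus, <- Rmult_assoc.
      apply Rmult_le_compat; try (apply Rlt_le, exp_pos); try lra.
      + apply Rmult_le_pos; [lra|apply Rlt_le, exp_pos].
      + apply Rle_trans with (2 := exp_le_one_minus y y1).
        apply exp_le, Ropp_le_contravar.
        replace (y / (1 - y)) with ((2 * INR u + 1) / (INR m - INR u))
          by (unfold y; field; lra).
        apply Rmult_le_compat_l; [lra|]. apply Rinv_le_contravar; lra. }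
  apply K. lia.
Qed.

(** The sequence increases, and it stays below [(m + 1/2) * walk m 0 ^ 2], which decreases from its
    value [1/2] at [m = 0]. *)
Lemma walk_0_asymptotic : exists c : R, is_lim_seq (fun m => INR m * walk m 0 ^ 2) c.
Proof.
  assert (B : forall m, (INR m + 1 / 2) * walk m 0 ^ 2 <= 1 / 2).
  { induction m as [|m IH]; [simpl; lra|].
    apply Rle_trans with (2 := IH). rewrite walk_succ_0, S_INR.
    assert (pm := pos_INR m).
    rewrite Rpow_mult_distr, <- Rmult_assoc.
    apply Rmult_le_compat_r; [apply pow2_ge_0|].
    apply Rminus_le_0.
    replace (_ - _) with (/ (8 * (INR m + 1) ^ 2) * (2 * INR m + 1)) by (field; lra).
    apply Rmult_le_pos; [|lra]. apply Rlt_le, Rinv_0_lt_compat. nra. }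
  destruct (ex_finite_lim_seq_incr (fun m => INR m * walk m 0 ^ 2) (1 / 2)) as [c Hc].
  - intros m. rewrite walk_succ_0, S_INR.
    assert (pm := pos_INR m).
    rewrite Rpow_mult_distr, <- Rmult_assoc.
    apply Rmult_le_compat_r; [apply pow2_ge_0|].
    apply Rminus_le_0.
    replace (_ - _) with (/ (4 * (INR m + 1))) by (field; lra).
    apply Rlt_le, Rinv_0_lt_compat. lra.
  - intros m. apply Rle_trans with (2 := B m).
    apply Rmult_le_compat_r; [apply pow2_ge_0|lra].
  - exists c. exact Hc.
Qed.

(** * Cosine sums *)

(** Twice the sum minus the term at [0] is the symmetric sum over [|v| <= N]. Multiplication by
    [cos x ^ 2 = (1 + cos (2x)) / 2] performs the double Pascal step on the weights; the last term
    is the boundary error of the truncation at [N]. *)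
Lemma cos_pow_step (m N : nat) (x : R) :
  2 * sum_f_R0 (fun v => walk (S m) v * cos (2 * INR v * x)) N - walk (S m) 0 =
  cos x ^ 2 * (2 * sum_f_R0 (fun v => walk m v * cos (2 * INR v * x)) N - walk m 0)
  + (walk m (S N) * cos (2 * INR N * x) - walk m N * cos (2 * INR (S N) * x)) / 2.
Proof.
  assert (C2 : cos x ^ 2 = (1 + cos (2 * x)) / 2) by (rewrite cos_2a_cos; field).
  induction N as [|N IH].
  - rewrite !sum_f_R0_0, C2. simpl INR. cbn [walk].
    replace (2 * 0 * x) with 0 by ring. replace (2 * 1 * x) with (2 * x) by ring.
    rewrite cos_0. field.
  - rewrite !tech5.
    set (A := sum_f_R0 _ N) in *. set (B := sum_f_R0 _ N) in *.
    assert (E : cos (2 * INR (S (S N)) * x) =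
       2 * cos (2 * x) * cos (2 * INR (S N) * x) - cos (2 * INR N * x)).
    { rewrite !S_INR.
      replace (2 * (INR N + 1 + 1) * x) with (2 * (INR N + 1) * x + 2 * x) by ring.
      replace (2 * INR N * x) with (2 * (INR N + 1) * x - 2 * x) by ring.
      rewrite cos_plus, cos_minus. ring. }
    rewrite E.
    assert (W : walk (S m) (S N) = (walk m N + 2 * walk m (S N) + walk m (S (S N))) / 4)
      by reflexivity.
    rewrite W. rewrite C2 in IH |- *.
    apply Rminus_diag_uniq. apply Rminus_diag_eq in IH.
    rewrite <- IH. field.
Qed.

(** The boundary error vanishes because the weights are zero beyond [m]. Leaving [N >= m] free
    allows a cutoff at a multiple of [2p+1] later. *)
Lemma cos_pow_expansion (m N : nat) (x : R) : (m <= N)%nat ->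
  cos x ^ (2 * m) = 2 * sum_f_R0 (fun v => walk m v * cos (2 * INR v * x)) N - walk m 0.
Proof.
  revert N. induction m as [|m IH]; intros N H.
  - assert (E : sum_f_R0 (fun v => walk 0 v * cos (2 * INR v * x)) N = 1).
    { clear H. induction N as [|N IN].
      - rewrite sum_f_R0_0. simpl. replace (2 * 0 * x) with 0 by ring. rewrite cos_0. ring.
      - rewrite tech5, IN. simpl. ring. }
    rewrite E. simpl. ring.
  - rewrite cos_pow_step, <- IH by lia.
    rewrite (walk_outside m N), (walk_outside m (S N)) by lia.
    replace (2 * S m)%nat with (2 + 2 * m)%nat by lia.
    rewrite pow_add. field.
Qed.

(** The sum over [|j| <= p] telescopes, since [2 sin a cos (2ja) = sin ((2j+1)a) - sin ((2j-1)a)].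
    Keeping the factor [sin a] avoids a division. *)
Lemma dirichlet_kernel (p : nat) (a : R) :
  sin a * (2 * sum_f_R0 (fun j => cos (2 * INR j * a)) p - 1) = sin (INR (2 * p + 1) * a).
Proof.
  induction p as [|p IH].
  - rewrite sum_f_R0_0. simpl. replace (2 * 0 * a) with 0 by ring.
    rewrite cos_0, Rmult_1_l. ring.
  - rewrite tech5.
    replace (INR (2 * S p + 1) * a) with (2 * INR (S p) * a + a)
      by (rewrite plus_INR, mult_INR; simpl (INR 2); simpl (INR 1); ring).
    replace (INR (2 * p + 1) * a) with (2 * INR (S p) * a - a) in IH
      by (rewrite plus_INR, mult_INR, S_INR; simpl (INR 2); simpl (INR 1); ring).
    rewrite sin_plus. rewrite sin_minus in IH. lra.
Qed.

Lemma cos_nat_period (n : nat) : cos (INR n * (2 * PI)) = 1.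
Proof.
  replace (INR n * (2 * PI)) with (0 + 2 * INR n * PI) by ring.
  rewrite cos_period. apply cos_0.
Qed.

Lemma sin_nat_PI (n : nat) : sin (INR n * PI) = 0.
Proof. rewrite INR_IZR_INZ. apply sin_eq_0_1. now exists (Z.of_nat n). Qed.

Lemma cos_sum_multiple (p k : nat) :
  2 * sum_f_R0 (fun j => cos (2 * INR (k * (2 * p + 1)) * (PI * INR j / INR (2 * p + 1)))) p - 1
  = INR (2 * p + 1).
Proof.
  assert (l0 : 0 < INR (2 * p + 1)) by (apply lt_0_INR; lia).
  rewrite (sum_f_R0_ext _ (fun _ => 1)).
  - rewrite sum_cte, plus_INR, mult_INR, S_INR. simpl. ring.
  - intros j. rewrite <- (cos_nat_period (k * j)). f_equal.
    rewrite !mult_INR. field. lra.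
Qed.

(** At [a = v PI / (2p+1)] the Dirichlet kernel identity has right side [sin (v PI) = 0], and
    [sin a = 0] would force [2p+1] to divide [v]. *)
Lemma cos_sum_non_multiple (p v : nat) :
  (forall k, v <> (k * (2 * p + 1))%nat) ->
  2 * sum_f_R0 (fun j => cos (2 * INR v * (PI * INR j / INR (2 * p + 1)))) p - 1 = 0.
Proof.
  intros H.
  assert (l0 : 0 < INR (2 * p + 1)) by (apply lt_0_INR; lia).
  assert (D := dirichlet_kernel p (INR v * PI / INR (2 * p + 1))).
  replace (INR (2 * p + 1) * (INR v * PI / INR (2 * p + 1))) with (INR v * PI) in D
    by (field; lra).
  rewrite sin_nat_PI in D.
  rewrite (sum_f_R0_ext _ (fun j => cos (2 * INR j * (INR v * PI / INR (2 * p + 1))))).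
  2:{ intros j. f_equal. field. lra. }
  destruct (Rmult_integral _ _ D) as [S|S]; [exfalso|exact S].
  apply sin_eq_0_0 in S. destruct S as [z Hz].
  assert (E : INR v = IZR z * INR (2 * p + 1)).
  { apply Rmult_eq_reg_r with (PI / INR (2 * p + 1)).
    - replace (INR v * (PI / INR (2 * p + 1))) with (INR v * PI / INR (2 * p + 1)) by (field; lra).
      rewrite Hz. field. lra.
    - apply Rgt_not_eq, Rdiv_lt_0_compat; [apply PI_RGT_0|lra]. }
  rewrite !INR_IZR_INZ, <- mult_IZR in E. apply eq_IZR in E.
  apply (H (Z.to_nat z)). nia.
Qed.

(* Expand [cos^(2m)] and exchange the sums; averaging over the angles kills every
   frequency that is not a multiple of [2p+1]. *)
Lemma cos_walk_identity (p m K : nat) : (m <= K)%nat ->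
  2 * sum_f_R0 (fun j => cos (PI * INR j / INR (2 * p + 1)) ^ (2 * m)) p - 1 =
  INR (2 * p + 1) * (2 * sum_f_R0 (fun k => walk m (k * (2 * p + 1))) K - walk m 0).
Proof.
  intros HK. set (l := (2 * p + 1)%nat).
  (* [D v] is the sum of frequency [v] over all angles [|j| <= p]: it is [l] when [l] divides [v],
     and [0] otherwise. *)
  set (D v := 2 * sum_f_R0 (fun j => cos (2 * INR v * (PI * INR j / INR l))) p - 1).
  assert (E : forall N, (m <= N)%nat ->
     2 * sum_f_R0 (fun j => cos (PI * INR j / INR l) ^ (2 * m)) p - 1 =
     2 * sum_f_R0 (fun v => walk m v * D v) N - walk m 0 * D 0%nat).
  { intros N HN.
    assert (G : forall q,
      sum_f_R0 (fun j => 2 * sum_f_R0 (fun v => walk m v * cos (2 * INR v * (PI * INR j / INR l))) N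
                      - walk m 0) q =
      2 * sum_f_R0 (fun v => walk m v * sum_f_R0 (fun j => cos (2 * INR v * (PI * INR j / INR l))) q) N
      - walk m 0 * sum_f_R0 (fun j => cos (2 * INR 0 * (PI * INR j / INR l))) q).
    { induction q as [|q IQ].
      - rewrite !sum_f_R0_0. rewrite (sum_f_R0_ext _ _ N (fun v => f_equal _ (sum_f_R0_0 _))).
        replace (2 * INR 0 * (PI * INR 0 / INR l)) with 0 by (simpl; ring).
        rewrite cos_0. ring.
      - rewrite tech5, IQ, tech5.
        rewrite (sum_f_R0_ext (fun v => walk m v * sum_f_R0 _ (S q))
          (fun v => walk m v * sum_f_R0 (fun j => cos (2 * INR v * (PI * INR j / INR l))) q
                     + (walk m v * cos (2 * INR v * (PI * INR (S q) / INR l))))).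
        2:{ intros v. rewrite tech5. ring. }
        rewrite plus_sum.
        replace (2 * INR 0 * (PI * INR (S q) / INR l)) with 0 by (simpl; ring).
        rewrite cos_0. ring. }
    rewrite (sum_f_R0_ext _ _ p (fun j => cos_pow_expansion m N _ HN)), G.
    rewrite (sum_f_R0_ext (fun v => walk m v * D v)
      (fun v => walk m v * sum_f_R0 (fun j => cos (2 * INR v * (PI * INR j / INR l))) p * 2
                  + walk m v * (-1))).
    2:{ intros v. unfold D. ring. }
    rewrite plus_sum, <- scal_sum, <- (scal_sum (walk m)).
    (* At [x = 0] the expansion says that the weights have total mass 1; this accounts for the [-1]
       on the left side. *)
    assert (X := cos_pow_expansion m N 0 HN).
    rewrite cos_0, pow1 in X.
    rewrite (sum_f_R0_ext _ (walk m)) in X.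
    2:{ intros v. rewrite Rmult_0_r, cos_0. ring. }
    unfold D. lra. }
  (* Summing in blocks of length [l], only the last index of each block contributes. *)
  assert (F : forall k, sum_f_R0 (fun v => walk m v * D v) (k * l) =
                        INR l * sum_f_R0 (fun k => walk m (k * l)) k).
  { assert (Dl : forall k, D (k * l)%nat = INR l) by (intros k; apply cos_sum_multiple).
    induction k as [|k IHk].
    - rewrite Nat.mul_0_l, !sum_f_R0_0. rewrite <- (Dl 0%nat). simpl. ring.
    - replace (S k * l)%nat with (k * l + S (2 * p))%nat by lia.
      rewrite sum_f_R0_lacuna.
      + replace (k * l + S (2 * p))%nat with (S k * l)%nat by lia.
        rewrite IHk, tech5, Dl. ring.
      + intros i Hi. unfold D, l. rewrite cos_sum_non_multiple; [ring|].
        intros k' ->. fold l in Hi.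
        assert (k < k' < S k)%nat; [|lia]. split; nia. }
  rewrite (E (K * l)%nat) by nia.
  rewrite F. replace (D 0%nat) with (INR l) by (symmetry; apply (cos_sum_multiple p 0)). ring.
Qed.

(** * Limits of the two sides *)

Lemma series_tail_le (u M : nat -> R) (n d : nat) :
  (forall j, (j <= n + d)%nat -> Rabs (u j) <= M j) ->
  Rabs (sum_f_R0 u (n + d) - sum_f_R0 u n) <= sum_f_R0 M (n + d) - sum_f_R0 M n.
Proof.
  induction d as [|d IH]; intros H.
  - rewrite Nat.add_0_r. rewrite !Rminus_diag, Rabs_R0. lra.
  - rewrite Nat.add_succ_r in H |- *. rewrite !tech5.
    specialize (IH ltac:(intros; apply H; lia)).
    specialize (H (S (n + d)) ltac:(lia)).
    apply Rle_trans with (Rabs (sum_f_R0 u (n + d) - sum_f_R0 u n) + Rabs (u (S (n + d)))).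
    + eapply Rle_trans; [|apply Rabs_triang]. right. f_equal. ring.
    + lra.
Qed.

Lemma is_lim_seq_sum_f_R0 (F : nat -> nat -> R) (f : nat -> R) (n : nat) :
  (forall j, is_lim_seq (fun p => F p j) (f j)) ->
  is_lim_seq (fun p => sum_f_R0 (F p) n) (sum_f_R0 f n).
Proof.
  intros H. induction n as [|n IH]; [apply H|].
  apply (is_lim_seq_plus' _ _ _ _ IH (H (S n))).
Qed.

Lemma is_series_sum_f_R0 (u : nat -> R) (l : R) :
  is_series u l <-> is_lim_seq (sum_f_R0 u) l.
Proof.
  split; intros H.
  - apply is_lim_seq_ext with (sum_n u); [intros; apply sum_n_Reals|exact H].
  - change (is_lim_seq (sum_n u) l).
    apply is_lim_seq_ext with (sum_f_R0 u); [intros; symmetry; apply sum_n_Reals|exact H].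
Qed.

Lemma Series_nonneg (u : nat -> R) :
  (forall n, 0 <= u n) -> ex_series u -> 0 <= Series u.
Proof.
  intros Hu Hs. apply Series_correct, is_series_sum_f_R0 in Hs.
  apply (is_lim_seq_le (fun _ => 0) (sum_f_R0 u) 0 (Series u)); [|apply is_lim_seq_const|exact Hs].
  intros n. apply cond_pos_sum, Hu.
Qed.

Lemma Series_ge_head (u : nat -> R) :
  (forall n, 0 <= u n) -> ex_series u -> u 0%nat <= Series u.
Proof.
  intros Hu Hs. rewrite Series_incr_1 by exact Hs.
  assert (0 <= Series (fun k => u (S k))); [|lra].
  apply Series_nonneg; [auto|]. apply (ex_series_incr_1 u), Hs.
Qed.

Lemma tannery (F : nat -> nat -> R) (f M : nat -> R) (N : nat -> nat) :
  (forall p j, (j <= N p)%nat -> Rabs (F p j) <= M j) ->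
  (forall p, (p <= N p)%nat) ->
  ex_series M ->
  (forall j, is_lim_seq (fun p => F p j) (f j)) ->
  is_lim_seq (fun p => sum_f_R0 (F p) (N p)) (Series f).
Proof.
  intros HF HN HM Hf.
  assert (HfM : forall j, Rabs (f j) <= M j).
  { intros j.
    apply (is_lim_seq_le_loc (fun p => Rabs (F p j)) (fun _ => M j) (Rabs (f j)) (M j)).
    - exists j. intros p Hp. apply HF. specialize (HN p). lia.
    - apply (is_lim_seq_abs _ (f j)), Hf.
    - apply is_lim_seq_const. }
  assert (Hs : ex_series f).
  { apply (ex_series_le (K := R_AbsRing) (V := R_CompleteNormedModule) f M); [|exact HM].
    intros n. apply HfM. }
  apply Series_correct, is_series_sum_f_R0 in Hs.
  destruct HM as [lM HM]. apply is_series_sum_f_R0 in HM.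
  apply is_lim_seq_Reals in Hs. apply is_lim_seq_Reals in HM.
  apply is_lim_seq_Reals.
  intros e He.
  (* Three errors of at most [e / 4] arise: the tail of [f], the termwise error up to [n], and the
     part of [M] between [n] and [N p], a difference of two partial sums each within [e / 8] of the
     limit. *)
  destruct (Hs (e / 4) ltac:(lra)) as [n1 H1].
  destruct (HM (e / 8) ltac:(lra)) as [n2 H2].
  set (n := max n1 n2).
  assert (H3 := is_lim_seq_sum_f_R0 F f n Hf).
  apply is_lim_seq_Reals in H3.
  destruct (H3 (e / 4) ltac:(lra)) as [n3 H4].
  exists (max n n3). intros p Hp.
  specialize (H4 p ltac:(lia)).
  specialize (H1 n ltac:(lia)).
  assert (H2n := H2 n ltac:(lia)).
  assert (HNp := HN p).
  assert (H2N := H2 (N p) ltac:(lia)).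
  assert (T : Rabs (sum_f_R0 (F p) (N p) - sum_f_R0 (F p) n) <= sum_f_R0 M (N p) - sum_f_R0 M n).
  { replace (N p) with (n + (N p - n))%nat by lia. apply series_tail_le.
    intros j Hj. apply HF. lia. }
  unfold Rdist in *.
  apply Rabs_def2 in H4. apply Rabs_def2 in H1. apply Rabs_def2 in H2n. apply Rabs_def2 in H2N.
  apply Rabs_le_between in T.
  apply Rabs_def1; lra.
Qed.

(** From [j <= j^2]: Gaussian terms get a geometric, hence summable, majorant. *)
Lemma exp_square_le (c : R) (j : nat) : 0 < c -> exp (- c * INR j ^ 2) <= exp (- c) ^ j.
Proof.
  intros Hc. rewrite exp_pow. apply exp_le.
  assert (INR j <= INR j ^ 2); [|nra].
  destruct j as [|j]; [simpl; lra|].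
  rewrite S_INR. assert (p := pos_INR j). nra.
Qed.

Lemma ex_series_exp_pow (c : R) : 0 < c -> ex_series (fun j => exp (- c) ^ j).
Proof.
  intros Hc. apply ex_series_geom.
  rewrite Rabs_pos_eq by apply Rlt_le, exp_pos.
  rewrite <- exp_0. apply exp_increasing. lra.
Qed.

(** * Gaussian bounds for powers of the cosine *)

Lemma x_cos_le_sin (x : R) : 0 <= x <= PI / 2 -> x * cos x <= sin x.
Proof.
  intros [H0 H1]. apply Rminus_le_0.
  destruct (MVT_gen (fun t => sin t - t * cos t) 0 x (fun t => t * sin t)) as [c [Hc E]].
  - intros t _. auto_derive; [trivial|ring].
  - intros t _. apply continuity_pt_minus; [apply continuity_sin|].
    apply continuity_pt_mult; [apply continuity_pt_id|apply continuity_cos].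
  - rewrite Rmin_left, Rmax_right in Hc by lra.
    rewrite sin_0 in E.
    assert (P := PI_RGT_0).
    assert (0 <= sin c) by (apply sin_ge_0; lra).
    assert (0 <= c * sin c * (x - 0)) by (apply Rmult_le_pos; [apply Rmult_le_pos|]; lra).
    lra.
Qed.

(** The function [cos t * exp (t^2 / 2)] equals 1 at [0] and does not increase: its derivative has
    the sign of [t cos t - sin t], which is at most [0] by [x_cos_le_sin]. *)
Lemma cos_le_gaussian (x : R) : 0 <= x <= PI / 2 -> cos x <= exp (- (x ^ 2 / 2)).
Proof.
  intros [H0 H1].
  assert (K : cos x * exp (x ^ 2 / 2) <= 1).
  { destruct (MVT_gen (fun t => cos t * exp (t ^ 2 / 2)) 0 x
      (fun t => (t * cos t - sin t) * exp (t ^ 2 / 2))) as [c [Hc E]].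
    - intros t _. auto_derive; [trivial|]. replace (t * (t * 1) * / 2) with (t ^ 2 / 2) by (simpl; field).
      field.
    - intros t _. apply derivable_continuous_pt.
      apply ex_derive_Reals_0. auto_derive. trivial.
    - rewrite Rmin_left, Rmax_right in Hc by lra.
      rewrite cos_0 in E. replace (0 ^ 2 / 2) with 0 in E by field. rewrite exp_0 in E.
      assert (L := x_cos_le_sin c ltac:(lra)).
      assert (0 <= (sin c - c * cos c) * exp (c ^ 2 / 2) * (x - 0)).
      { apply Rmult_le_pos; [apply Rmult_le_pos|]; try lra. apply Rlt_le, exp_pos. }
      lra. }
  rewrite exp_Ropp. apply Rmult_le_reg_r with (exp (x ^ 2 / 2)); [apply exp_pos|].
  rewrite Rinv_l; [exact K|apply Rgt_not_eq, exp_pos].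
Qed.

Lemma cos_pow_upper (x : R) (m : nat) : 0 <= x <= PI / 2 ->
  0 <= cos x ^ (2 * m) <= exp (- (INR m * x ^ 2)).
Proof.
  intros H.
  assert (C : 0 <= cos x) by (apply cos_ge_0; lra).
  split; [apply pow_le, C|].
  replace (- (INR m * x ^ 2)) with (INR (2 * m) * (- (x ^ 2 / 2)))
    by (rewrite mult_INR; simpl; field).
  rewrite <- exp_pow. apply pow_incr. split; [exact C|apply cos_le_gaussian, H].
Qed.

(** From [cos^2 x = 1 - sin^2 x >= 1 - x^2] and [exp_le_one_minus]. *)
Lemma cos_pow_lower (x : R) (m : nat) : 0 <= x < 1 ->
  exp (- (INR m * x ^ 2 / (1 - x ^ 2))) <= cos x ^ (2 * m).
Proof.
  intros H.
  assert (S : sin x ^ 2 <= x ^ 2).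
  { apply pow_incr. split.
    - apply sin_ge_0; generalize PI2_1 PI_RGT_0; lra.
    - destruct (Req_dec x 0) as [->|N]; [rewrite sin_0; lra|].
      apply Rlt_le, sin_lt_x; lra. }
  assert (C := sin2_cos2 x). unfold Rsqr in C.
  rewrite pow_mult.
  replace (- (INR m * x ^ 2 / (1 - x ^ 2))) with (INR m * - (x ^ 2 / (1 - x ^ 2)))
    by (field; nra).
  rewrite <- exp_pow. apply pow_incr. split; [apply Rlt_le, exp_pos|].
  apply Rle_trans with (1 := exp_le_one_minus (x ^ 2) ltac:(nra)).
  nra.
Qed.

(** * The scaling [m ~ s l^2 / PI] and the termwise limits *)

Definition odd_len (p : nat) : R := INR (2 * p + 1).
(** The [m] of the cosine identity, chosen so that [m (PI j / l)^2] is close to [PI s j^2]. Rounding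
    up makes the Gaussian bound on the cosine terms hold with exactly [s]. *)
Definition steps (s : R) (p : nat) : nat := Z.to_nat (up (s / PI * odd_len p ^ 2)).

Lemma odd_len_ge (p : nat) : 1 <= odd_len p.
Proof. unfold odd_len. rewrite plus_INR. simpl (INR 1). generalize (pos_INR (2 * p)). lra. Qed.

Lemma steps_bounds (s : R) (p : nat) : 0 < s ->
  s / PI * odd_len p ^ 2 < INR (steps s p) <= s / PI * odd_len p ^ 2 + 1.
Proof.
  intros Hs. unfold steps.
  destruct (archimed (s / PI * odd_len p ^ 2)) as [A B].
  set (z := up _) in *.
  assert (L := odd_len_ge p).
  assert (0 < s / PI) by (apply Rdiv_lt_0_compat; [lra|apply PI_RGT_0]).
  assert (0 < s / PI * odd_len p ^ 2) by (apply Rmult_lt_0_compat; nra).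
  assert (0 < z)%Z by (apply lt_IZR; lra).
  rewrite INR_IZR_INZ, Z2Nat.id by lia. lra.
Qed.

Lemma inv_odd_len_lim : is_lim_seq (fun p => / odd_len p) 0.
Proof.
  replace (Finite 0) with (Rbar_inv p_infty) by reflexivity.
  apply is_lim_seq_inv; [|discriminate].
  apply is_lim_seq_le_p_loc with INR; [|apply is_lim_seq_INR].
  exists 0%nat. intros p _. unfold odd_len. apply le_INR. lia.
Qed.

Lemma steps_ratio_lim (s : R) : 0 < s ->
  is_lim_seq (fun p => INR (steps s p) / odd_len p ^ 2) (s / PI).
Proof.
  intros Hs.
  apply is_lim_seq_le_le with (fun _ => s / PI)
    (fun p => s / PI + / odd_len p * / odd_len p).
  - intros p. assert (L := odd_len_ge p). assert (B := steps_bounds s p Hs).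
    assert (L2 : 0 < odd_len p ^ 2) by nra.
    split.
    + apply (Rle_div_r (s / PI)); [exact L2|lra].
    + apply Rle_div_l; [lra|].
      replace ((s / PI + / odd_len p * / odd_len p) * odd_len p ^ 2)
        with (s / PI * odd_len p ^ 2 + 1); [lra|].
      field. generalize PI_RGT_0. lra.
  - apply is_lim_seq_const.
  - replace (s / PI) with (s / PI + 0 * 0) at 1 by ring.
    apply is_lim_seq_plus'; [apply is_lim_seq_const|].
    apply is_lim_seq_mult'; apply inv_odd_len_lim.
Qed.

(** Allows the limit of [m * walk m 0 ^ 2] to be taken along [m = steps s p]. *)
Lemma steps_eventually (s : R) : 0 < s -> filterlim (steps s) eventually eventually.
Proof.
  intros Hs P [N HN].
  assert (s0 : 0 < s / PI) by (apply Rdiv_lt_0_compat; [lra|apply PI_RGT_0]).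
  destruct (nfloor_ex (INR N / (s / PI))) as [k Hk].
  { apply Rdiv_le_0_compat; [apply pos_INR|lra]. }
  exists (S k). intros p Hp. apply HN.
  apply INR_le. apply Rle_trans with (2 := Rlt_le _ _ (proj1 (steps_bounds s p Hs))).
  rewrite Rmult_comm. apply Rle_div_l; [lra|].
  assert (L := odd_len_ge p).
  assert (INR (S k) <= odd_len p) by (apply le_INR; lia).
  rewrite S_INR in H. nra.
Qed.

Lemma is_lim_seq_exp (u : nat -> R) (l : R) :
  is_lim_seq u l -> is_lim_seq (fun n => exp (u n)) (exp l).
Proof.
  apply is_lim_seq_continuous. apply derivable_continuous_pt, derivable_pt_exp.
Qed.

Lemma is_lim_seq_opp' (u : nat -> R) (l : R) :
  is_lim_seq u l -> is_lim_seq (fun n => - u n) (- l).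
Proof. exact (proj1 (is_lim_seq_opp u l)). Qed.

Definition theta_term (s : R) (k : nat) : R := exp (- (PI * s) * INR k ^ 2).

(** For [j <= p] the angle is below [PI / 2], so [cos_pow_upper] applies, and [m PI / l^2 >= s] by
    the rounding. The limit term itself is thus a majorant uniform in [p]. *)
Lemma cos_term_bound (s : R) (p j : nat) : 0 < s -> (j <= p)%nat ->
  0 <= cos (PI * INR j / odd_len p) ^ (2 * steps s p) <= theta_term s j.
Proof.
  intros Hs Hj.
  assert (L := odd_len_ge p). assert (P := PI_RGT_0). assert (J := pos_INR j).
  destruct (cos_pow_upper (PI * INR j / odd_len p) (steps s p)) as [A B].
  - split.
    + apply Rdiv_le_0_compat; nra.
    + apply Rle_div_l; [lra|].
      assert (2 * INR j <= odd_len p).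
      { unfold odd_len. rewrite plus_INR, mult_INR. simpl. apply le_INR in Hj. lra. }
      nra.
  - split; [exact A|]. apply Rle_trans with (1 := B). apply exp_le.
    assert (S := steps_bounds s p Hs).
    replace (INR (steps s p) * (PI * INR j / odd_len p) ^ 2)
      with (INR (steps s p) * (PI / odd_len p ^ 2) * (PI * INR j ^ 2)) by (field; lra).
    assert (s <= INR (steps s p) * (PI / odd_len p ^ 2)).
    { apply Rmult_le_reg_r with (odd_len p ^ 2 / PI).
      - apply Rdiv_lt_0_compat; nra.
      - replace (INR (steps s p) * (PI / odd_len p ^ 2) * (odd_len p ^ 2 / PI))
          with (INR (steps s p)) by (field; lra).
        unfold Rdiv in *. lra. }
    assert (0 <= PI * INR j ^ 2) by (apply Rmult_le_pos; nra).
    nra.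
Qed.

(** Squeeze: the upper bound is already the limit, and the defect [1 - x^2] in [cos_pow_lower] tends
    to 1. *)
Lemma cos_term_lim (s : R) (j : nat) : 0 < s ->
  is_lim_seq (fun p => cos (PI * INR j / odd_len p) ^ (2 * steps s p)) (theta_term s j).
Proof.
  intros Hs. assert (P := PI_RGT_0).
  set (x p := PI * INR j * / odd_len p).
  assert (X : is_lim_seq x 0).
  { replace 0 with (PI * INR j * 0) by ring. apply (is_lim_seq_scal_l _ _ 0), inv_odd_len_lim. }
  apply is_lim_seq_le_le_loc with
    (fun p => exp (- (INR (steps s p) / odd_len p ^ 2 * (PI * INR j) ^ 2 / (1 - x p * x p))))
    (fun _ => theta_term s j).
  - assert (X1 : eventually (fun p => Rabs (x p - 0) < 1)).
    { apply is_lim_seq_spec in X. exact (X (mkposreal 1 Rlt_0_1)). }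
    destruct X1 as [N HN]. exists (max N j). intros p Hp.
    specialize (HN p ltac:(lia)).
    assert (x0 : 0 <= x p).
    { apply Rmult_le_pos; [apply Rmult_le_pos; [lra|apply pos_INR]|].
      apply Rlt_le, Rinv_0_lt_compat. generalize (odd_len_ge p); lra. }
    split; [|apply cos_term_bound; [exact Hs|lia]].
    rewrite Rminus_0_r, Rabs_pos_eq in HN by exact x0.
    apply Rle_trans with (2 := cos_pow_lower (x p) (steps s p) (conj x0 HN)).
    right. do 2 f_equal. unfold Rdiv. simpl (x p ^ 2). rewrite Rmult_1_r. f_equal.
    unfold x. field. generalize (odd_len_ge p); lra.
  - apply is_lim_seq_exp.
    replace (- (PI * s) * INR j ^ 2)
      with (- (s / PI * (PI * INR j) ^ 2 / (1 - 0 * 0))) by (field; lra).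
    apply is_lim_seq_opp'. apply is_lim_seq_div'.
    + apply is_lim_seq_mult'; [apply steps_ratio_lim, Hs|apply is_lim_seq_const].
    + apply is_lim_seq_minus'; [apply is_lim_seq_const|now apply is_lim_seq_mult'].
    + lra.
  - apply is_lim_seq_const.
Qed.

Lemma walk_term_bound (s : R) (p k : nat) : 0 < s ->
  0 <= walk (steps s p) (k * (2 * p + 1)) / walk (steps s p) 0
    <= exp (- (PI / (2 * (s + PI))) * INR k ^ 2).
Proof.
  intros Hs. assert (P := PI_RGT_0). assert (L := odd_len_ge p).
  assert (W := walk_0_pos (steps s p)). assert (B := steps_bounds s p Hs).
  assert (s0 : 0 < s / PI) by (apply Rdiv_lt_0_compat; lra).
  assert (m0 : 0 < INR (steps s p)) by nra.
  destruct (le_lt_dec (k * (2 * p + 1)) (steps s p)) as [H|H].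
  2:{ rewrite walk_outside by exact H. replace (0 / walk (steps s p) 0) with 0 by (field; lra).
      split; [lra|apply Rlt_le, exp_pos]. }
  destruct (walk_upper (steps s p) (k * (2 * p + 1)) H) as [U1 U2].
  { apply INR_lt. exact m0. }
  split; [apply Rdiv_le_0_compat; lra|].
  apply Rle_div_l; [lra|]. rewrite Rmult_comm.
  apply Rle_trans with (1 := U2). apply Rmult_le_compat_l; [lra|].
  apply exp_le.
  apply le_INR in H. rewrite mult_INR in *. fold (odd_len p) in *.
  set (m := INR (steps s p)) in *. set (l := odd_len p) in *.
  assert (K := pos_INR k).
  assert (V : 0 <= INR k * l) by nra.
  rewrite Ropp_mult_distr_l_reverse. apply Ropp_le_contravar.
  replace ((INR k * l) ^ 2 / (m + INR k * l)) with (l ^ 2 / (m + INR k * l) * INR k ^ 2)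
    by (field; lra).
  apply Rmult_le_compat_r; [nra|].
  apply (Rle_div_r (PI / (2 * (s + PI)))); [lra|].
  (* Inside the support [k l <= m], hence [m + k l <= 2 m <= 2 (s / PI + 1) l^2]. This is the source
     of the constant [PI / (2 (s + PI))]. *)
  apply Rle_trans with (PI / (2 * (s + PI)) * (2 * (s / PI * l ^ 2 + l ^ 2))).
  - apply Rmult_le_compat_l; [apply Rlt_le, Rdiv_lt_0_compat; lra|]. nra.
  - right. field. lra.
Qed.

(** Squeeze between [walk_lower] and [walk_upper] at [v = k l]: as [v] has order [l] and [m] has
    order [l^2], both exponents tend to [- PI k^2 / s]. *)
Lemma walk_term_lim (s : R) (k : nat) : 0 < s ->
  is_lim_seq (fun p => walk (steps s p) (k * (2 * p + 1)) / walk (steps s p) 0)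
    (theta_term (/ s) k).
Proof.
  intros Hs. assert (P := PI_RGT_0).
  assert (s0 : 0 < s / PI) by (apply Rdiv_lt_0_compat; lra).
  set (r p := INR (steps s p) / odd_len p ^ 2).
  assert (R := steps_ratio_lim s Hs).
  assert (O := inv_odd_len_lim).
  assert (KO : is_lim_seq (fun p => INR k * / odd_len p) 0).
  { replace 0 with (INR k * 0) by ring. apply (is_lim_seq_scal_l _ _ 0), O. }
  apply is_lim_seq_le_le_loc with
    (fun p => exp (- (INR k ^ 2 / (r p - INR k * / odd_len p + / odd_len p * / odd_len p))))
    (fun p => exp (- (INR k ^ 2 / (r p + INR k * / odd_len p)))).
  - assert (X1 : eventually (fun p => Rabs (INR k * / odd_len p - 0) < s / PI)).
    { apply is_lim_seq_spec in KO. exact (KO (mkposreal _ s0)). }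
    destruct X1 as [N HN]. exists N. intros p Hp.
    specialize (HN p Hp). rewrite Rminus_0_r in HN.
    assert (L := odd_len_ge p). assert (B := steps_bounds s p Hs).
    assert (W := walk_0_pos (steps s p)).
    (* Once [k / l < s / PI], the index [k l] lies inside the support of the weights. *)
    assert (Hl : (k * (2 * p + 1) <= steps s p)%nat).
    { apply INR_le. rewrite mult_INR. fold (odd_len p).
      apply Rle_trans with (2 := Rlt_le _ _ (proj1 B)).
      apply Rabs_def2 in HN.
      replace (INR k * odd_len p) with (INR k * / odd_len p * odd_len p ^ 2) by (field; lra).
      apply Rmult_le_compat_r; [nra|lra]. }
    assert (H1 := Hl). apply le_INR in H1.
    assert (V := pos_INR (k * (2 * p + 1))).
    assert (m0 : 0 < INR (steps s p)) by nra.
    split.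
    + apply Rle_div_r; [lra|]. rewrite Rmult_comm.
      eapply Rle_trans; [|apply walk_lower, Hl]. right. do 3 f_equal.
      rewrite mult_INR in *. fold (odd_len p) in *. unfold r. field. nra.
    + apply Rle_div_l; [lra|]. rewrite Rmult_comm.
      eapply Rle_trans; [apply walk_upper; [exact Hl|apply INR_lt; exact m0]|]. right. do 3 f_equal.
      rewrite mult_INR in *. fold (odd_len p) in *. unfold r. field. nra.
  - apply is_lim_seq_exp.
    replace (- (PI * / s) * INR k ^ 2)
      with (- (INR k ^ 2 / (s / PI - 0 + 0 * 0))) by (field; lra).
    apply is_lim_seq_opp'. apply is_lim_seq_div'.
    + apply is_lim_seq_const.
    + apply is_lim_seq_plus'; [now apply is_lim_seq_minus'|now apply is_lim_seq_mult'].
    + lra.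
  - apply is_lim_seq_exp.
    replace (- (PI * / s) * INR k ^ 2)
      with (- (INR k ^ 2 / (s / PI + 0))) by (field; lra).
    apply is_lim_seq_opp'. apply is_lim_seq_div'.
    + apply is_lim_seq_const.
    + now apply is_lim_seq_plus'.
    + lra.
Qed.

(** * The inversion formula *)

Definition theta_series (s : R) : R := 2 * Series (theta_term s) - 1.

Lemma ex_series_theta_term (s : R) : 0 < s -> ex_series (theta_term s).
Proof.
  intros Hs. assert (P := PI_RGT_0).
  assert (0 < PI * s) by nra.
  apply (ex_series_le (K := R_AbsRing) (V := R_CompleteNormedModule) _ (fun j => exp (- (PI * s)) ^ j)).
  - intros n. unfold norm; simpl. unfold abs; simpl.
    rewrite Rabs_pos_eq by apply Rlt_le, exp_pos. now apply exp_square_le.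
  - now apply ex_series_exp_pow.
Qed.

Lemma theta_series_ge_1 (s : R) : 0 < s -> 1 <= theta_series s.
Proof.
  intros Hs. unfold theta_series.
  assert (H := Series_ge_head (theta_term s) (fun n => Rlt_le _ _ (exp_pos _))
                 (ex_series_theta_term s Hs)).
  replace (theta_term s 0) with 1 in H; [lra|].
  unfold theta_term. simpl (INR 0). replace (_ * 0 ^ 2) with 0 by ring.
  symmetry. apply exp_0.
Qed.

(** Limit of [cos_walk_identity] along [m = steps s p]. The identity is squared first, because it is
    [m * walk m 0 ^ 2] that is known to converge. *)
Lemma theta_series_scaled (c : R) : is_lim_seq (fun m => INR m * walk m 0 ^ 2) c ->
  forall s, 0 < s -> s * theta_series s ^ 2 = PI * c * theta_series (/ s) ^ 2.
Proof.
  intros Hc s Hs. assert (P := PI_RGT_0).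
  assert (s0 : 0 < s / PI) by (apply Rdiv_lt_0_compat; lra).
  set (A p := 2 * sum_f_R0 (fun j => cos (PI * INR j / odd_len p) ^ (2 * steps s p)) p - 1).
  (* The cutoff [steps s p + p] is at least [m], as [cos_walk_identity] asks, and at least [p], as
     [tannery] asks. *)
  set (B p := 2 * sum_f_R0 (fun k => walk (steps s p) (k * (2 * p + 1)) / walk (steps s p) 0)
                (steps s p + p) - 1).
  assert (LA : is_lim_seq A (theta_series s)).
  { apply is_lim_seq_minus'; [|apply is_lim_seq_const].
    apply (is_lim_seq_scal_l _ _ (Finite _)).
    apply (tannery (fun p j => cos (PI * INR j / odd_len p) ^ (2 * steps s p))
             (theta_term s) (theta_term s) (fun p => p)).
    - intros p j Hj. destruct (cos_term_bound s p j Hs Hj).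
      now rewrite Rabs_pos_eq.
    - intros; lia.
    - now apply ex_series_theta_term.
    - intros j. now apply cos_term_lim. }
  assert (LB : is_lim_seq B (theta_series (/ s))).
  { apply is_lim_seq_minus'; [|apply is_lim_seq_const].
    apply (is_lim_seq_scal_l _ _ (Finite _)).
    assert (C : 0 < PI / (2 * (s + PI))) by (apply Rdiv_lt_0_compat; lra).
    apply (tannery (fun p k => walk (steps s p) (k * (2 * p + 1)) / walk (steps s p) 0)
             (theta_term (/ s)) (fun k => exp (- (PI / (2 * (s + PI)))) ^ k)
             (fun p => (steps s p + p)%nat)).
    - intros p j _. destruct (walk_term_bound s p j Hs).
      rewrite Rabs_pos_eq by assumption.
      apply Rle_trans with (1 := H0). now apply exp_square_le.
    - intros; lia.
    - now apply ex_series_exp_pow.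
    - intros j. now apply walk_term_lim. }
  assert (E : forall p, INR (steps s p) / odd_len p ^ 2 * (A p * A p) =
     INR (steps s p) * walk (steps s p) 0 ^ 2 * (B p * B p)).
  { intros p. assert (L := odd_len_ge p).
    assert (I : A p = odd_len p * walk (steps s p) 0 * B p).
    { unfold A, B. unfold odd_len.
      rewrite (cos_walk_identity p (steps s p) (steps s p + p)) by lia.
      unfold Rdiv. rewrite <- scal_sum. field.
      apply Rgt_not_eq, walk_0_pos. }
    rewrite I. field. lra. }
  assert (F : s / PI * (theta_series s * theta_series s) =
              c * (theta_series (/ s) * theta_series (/ s))).
  { apply Rbar_finite_eq.
    rewrite <- (is_lim_seq_unique (fun p => INR (steps s p) / odd_len p ^ 2 * (A p * A p))
                  (s / PI * (theta_series s * theta_series s))).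
    - apply is_lim_seq_unique.
      apply (is_lim_seq_ext _ _ _ (fun p => eq_sym (E p))).
      apply is_lim_seq_mult'; [|now apply is_lim_seq_mult'].
      apply (is_lim_seq_subseq _ _ _ (steps_eventually s Hs) Hc).
    - apply is_lim_seq_mult'; [|now apply is_lim_seq_mult'].
      now apply steps_ratio_lim. }
  replace (s * theta_series s ^ 2) with (PI * (s / PI * (theta_series s * theta_series s)))
    by (field; lra).
  rewrite F. ring.
Qed.

Lemma theta_series_inversion (s : R) : 0 < s ->
  s * theta_series s ^ 2 = theta_series (/ s) ^ 2.
Proof.
  intros Hs. destruct walk_0_asymptotic as [c Hc].
  assert (H1 := theta_series_scaled c Hc 1 Rlt_0_1).
  rewrite Rinv_1 in H1. assert (G := theta_series_ge_1 1 Rlt_0_1).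
  assert (E : PI * c = 1).
  { apply Rmult_eq_reg_r with (theta_series 1 ^ 2); [lra|nra]. }
  rewrite (theta_series_scaled c Hc s Hs), E. ring.
Qed.

(** * Theta as a lacunary power series *)

Lemma theta3_partial_theta_term (s : R) (n : nat) :
  theta3_partial s n = 2 * sum_f_R0 (theta_term s) n - 1.
Proof.
  unfold theta3_partial.
  set (g z := exp (- PI * IZR z ^ 2 * s)).
  change (sum_f_R0 (fun j => g (Z.of_nat j - Z.of_nat n)%Z) (2 * n) = 2 * sum_f_R0 (theta_term s) n - 1).
  assert (G : forall k, g (Z.of_nat k) = theta_term s k).
  { intros k. unfold g, theta_term. rewrite INR_IZR_INZ. f_equal. ring. }
  assert (G' : forall z, g (- z)%Z = g z).
  { intros z. unfold g. rewrite opp_IZR. f_equal. ring. }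
  induction n as [|n IH].
  - simpl. rewrite <- (G 0%nat). simpl. unfold g. replace (- PI * 0 ^ 2 * s) with 0 by ring.
    rewrite exp_0. ring.
  (* Recentring from [n] to [n + 1] shifts the old range and adds one term at each end, for
     [k = -(n+1)] and [k = n+1]; the two are equal. *)
  - replace (2 * S n)%nat with (S (S (2 * n))) by lia.
    rewrite decomp_sum by lia. rewrite Nat.pred_succ.
    rewrite !tech5.
    rewrite (sum_f_R0_ext _ (fun j => g (Z.of_nat j - Z.of_nat n)%Z)).
    2:{ intros j. f_equal. lia. }
    rewrite IH.
    replace (Z.of_nat 0 - Z.of_nat (S n))%Z with (- Z.of_nat (S n))%Z by lia.
    replace (Z.of_nat (S (S (2 * n))) - Z.of_nat (S n))%Z with (Z.of_nat (S n)) by lia.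
    rewrite G', G. ring.
Qed.

Lemma theta3_theta_series (s : R) : 0 < s -> theta3 s = theta_series s.
Proof.
  intros Hs.
  assert (L : Un_cv (theta3_partial s) (theta_series s)).
  { apply is_lim_seq_Reals.
    apply is_lim_seq_ext with (fun n => 2 * sum_f_R0 (theta_term s) n - 1).
    - intros n. symmetry. apply theta3_partial_theta_term.
    - apply is_lim_seq_minus'; [|apply is_lim_seq_const].
      apply (is_lim_seq_scal_l _ _ (Finite _)).
      apply is_series_sum_f_R0, Series_correct, ex_series_theta_term, Hs. }
  apply UL_sequence with (theta3_partial s); [|exact L].
  unfold theta3. apply epsilon_spec. now exists (theta_series s).
Qed.

(** With these coefficients theta is an ordinary power series in [q = exp (- PI * s)], so termwise
    differentiation comes from the theory of [PSeries]. *)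
Definition square_coeff (n : nat) : R :=
  if Nat.eqb (Nat.sqrt n * Nat.sqrt n) n then 1 else 0.

Lemma square_coeff_bounds (n : nat) : 0 <= square_coeff n <= 1.
Proof. unfold square_coeff. destruct Nat.eqb; lra. Qed.

Lemma square_coeff_radius (x : R) : 0 <= x < 1 -> Rbar_lt (Rabs x) (CV_radius square_coeff).
Proof.
  intros H. apply Rbar_lt_le_trans with 1.
  - simpl. rewrite Rabs_pos_eq; lra.
  - apply (proj1 (CV_radius_bounded square_coeff)). exists 1. intros n.
    rewrite pow1, Rmult_1_r. assert (B := square_coeff_bounds n).
    rewrite Rabs_pos_eq; lra.
Qed.

Lemma sum_square_coeff (x : R) (n : nat) :
  sum_f_R0 (fun i => square_coeff i * x ^ i) (n * n) = sum_f_R0 (fun k => x ^ (k * k)) n.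
Proof.
  assert (Q : forall k, square_coeff (k * k) = 1).
  { intros k. unfold square_coeff. now rewrite Nat.sqrt_square, Nat.eqb_refl. }
  induction n as [|n IH].
  - simpl. change (square_coeff 0) with 1. ring.
  - replace (S n * S n)%nat with (n * n + S (2 * n))%nat by lia.
    rewrite sum_f_R0_lacuna.
    + replace (n * n + S (2 * n))%nat with (S n * S n)%nat by lia.
      rewrite IH, tech5, Q. ring.
    + intros i Hi. unfold square_coeff.
      rewrite (Nat.sqrt_unique i n) by lia.
      destruct (Nat.eqb_spec (n * n) i); [lia|ring].
Qed.

Lemma ex_series_pseries (a : nat -> R) (x : R) :
  Rbar_lt (Rabs x) (CV_radius a) -> ex_series (fun n => a n * x ^ n).
Proof. intros H. apply ex_series_Rabs, CV_disk_inside, H. Qed.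

Lemma nome_bounds (s : R) : 0 < s -> 0 <= exp (- PI * s) < 1.
Proof.
  intros Hs. split; [apply Rlt_le, exp_pos|].
  rewrite <- exp_0. apply exp_increasing. generalize PI_RGT_0. nra.
Qed.

(** The partial sums of the power series at the indices [n^2] are the partial sums of the theta
    series; both sequences converge, so the limits agree. *)
Lemma theta_series_PSeries (s : R) : 0 < s ->
  theta_series s = 2 * PSeries square_coeff (exp (- PI * s)) - 1.
Proof.
  intros Hs. unfold theta_series, PSeries. do 2 f_equal.
  assert (H := ex_series_pseries _ _ (square_coeff_radius _ (nome_bounds s Hs))).
  apply Series_correct, is_series_sum_f_R0 in H.
  assert (K := ex_series_theta_term s Hs).
  apply Series_correct, is_series_sum_f_R0 in K.
  assert (SQ : filterlim (fun n => (n * n)%nat) eventually eventually).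
  { intros P [N HN]. exists N. intros n Hn. apply HN. nia. }
  apply (is_lim_seq_subseq _ _ _ SQ) in H.
  apply (is_lim_seq_ext _ (sum_f_R0 (theta_term s))) in H.
  - apply is_lim_seq_unique in H. apply is_lim_seq_unique in K.
    rewrite K in H. apply Rbar_finite_eq. exact H.
  - intros n. rewrite sum_square_coeff. apply sum_f_R0_ext. intros k.
    unfold theta_term. rewrite exp_pow, mult_INR. f_equal. ring.
Qed.

Lemma PSeries_ge_head (a : nat -> R) (x : R) : (forall n, 0 <= a n) -> 0 <= x ->
  Rbar_lt (Rabs x) (CV_radius a) -> a 0%nat <= PSeries a x.
Proof.
  intros Ha Hx H.
  replace (a 0%nat) with (a 0%nat * x ^ 0) by (simpl; ring).
  apply (Series_ge_head (fun n => a n * x ^ n)).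
  - intros n. apply Rmult_le_pos; [apply Ha|apply pow_le, Hx].
  - now apply ex_series_pseries.
Qed.

Lemma PS_derive_nonneg (a : nat -> R) :
  (forall n, 0 <= a n) -> forall n, 0 <= PS_derive a n.
Proof. intros H n. apply Rmult_le_pos; [apply pos_INR|apply H]. Qed.

(** The coefficients of the derivative are at most [n + 1 <= 2^n], which leaves a geometric
    series. *)
Lemma PSeries_derive_square_le (x : R) : 0 <= x < 1 / 2 ->
  PSeries (PS_derive square_coeff) x <= / (1 - 2 * x).
Proof.
  intros H. rewrite <- Series_geom by (rewrite Rabs_pos_eq; lra).
  apply Series_le.
  - intros n. assert (B := square_coeff_bounds (S n)). assert (X := pow_le x n ltac:(lra)).
    split.
    + apply Rmult_le_pos; [|exact X].
      apply PS_derive_nonneg. intros; apply square_coeff_bounds.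
    + rewrite Rpow_mult_distr. apply Rmult_le_compat_r; [exact X|].
      apply Rle_trans with (INR (S n)).
      * unfold PS_derive. assert (p := pos_INR (S n)). nra.
      * clear. induction n as [|n IH]; [simpl; lra|].
        rewrite S_INR. change (2 ^ S n) with (2 * 2 ^ n).
        assert (1 <= 2 ^ n) by (apply pow_R1_Rle; lra). lra.
  - apply ex_series_geom. rewrite Rabs_pos_eq; lra.
Qed.

(** * Derivatives of theta *)

Definition theta_d1 (s : R) : R :=
  - (2 * PI) * (exp (- PI * s) * PSeries (PS_derive square_coeff) (exp (- PI * s))).

(** Since [dq/ds = - PI q], differentiation in [s] is [- PI q d/dq]; applied twice to [P(q)] it
    gives [PI^2 (q P' + q^2 P'')]. *)
Definition theta_d2 (s : R) : R :=
  2 * PI ^ 2 * (exp (- PI * s) * PSeries (PS_derive square_coeff) (exp (- PI * s))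
    + exp (- PI * s) ^ 2 * PSeries (PS_derive (PS_derive square_coeff)) (exp (- PI * s))).

Lemma is_derive_nome (s : R) : is_derive (fun t => exp (- PI * t)) s (- PI * exp (- PI * s)).
Proof. auto_derive; [trivial|ring]. Qed.

Lemma is_derive_PSeries_nome (a : nat -> R) (s : R) :
  Rbar_lt (Rabs (exp (- PI * s))) (CV_radius a) ->
  is_derive (fun t => PSeries a (exp (- PI * t))) s
    (- PI * exp (- PI * s) * PSeries (PS_derive a) (exp (- PI * s))).
Proof.
  intros H.
  apply (is_derive_comp (PSeries a) (fun t => exp (- PI * t))).
  - now apply is_derive_PSeries.
  - apply is_derive_nome.
Qed.

Lemma theta3_derive (s : R) : 0 < s -> is_derive theta3 s (theta_d1 s).
Proof.
  intros Hs.
  apply is_derive_ext_loc with (fun t => 2 * PSeries square_coeff (exp (- PI * t)) - 1).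
  (* A neighbourhood of radius [s] stays in [t > 0], where [theta3] equals the power series. *)
  - exists (mkposreal s Hs). intros t Ht.
    apply Rabs_def2 in Ht. unfold minus, plus, opp in Ht; simpl in Ht.
    rewrite theta3_theta_series, theta_series_PSeries by lra. reflexivity.
  - assert (D := is_derive_PSeries_nome square_coeff s (square_coeff_radius _ (nome_bounds s Hs))).
    evar_last.
    + apply (is_derive_minus (fun t => 2 * PSeries square_coeff (exp (- PI * t))) (fun _ => 1)).
      * apply is_derive_scal, D.
      * apply is_derive_const.
    + unfold theta_d1, minus, plus, opp, zero; simpl. ring.
Qed.

Lemma theta_d1_derive (s : R) : 0 < s -> is_derive theta_d1 s (theta_d2 s).
Proof.
  intros Hs.
  assert (D := is_derive_PSeries_nome (PS_derive square_coeff) s).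
  rewrite CV_radius_derive in D.
  specialize (D (square_coeff_radius _ (nome_bounds s Hs))).
  unfold theta_d1.
  evar_last.
  - apply is_derive_scal.
    apply (is_derive_mult (fun t => exp (- PI * t))
             (fun t => PSeries (PS_derive square_coeff) (exp (- PI * t))));
      [apply is_derive_nome|exact D|intros; apply Rmult_comm].
  - unfold theta_d2, plus, mult; simpl. ring.
Qed.

(** The coefficient of [q] is 1 and all coefficients are nonnegative, so the derived series is at
    least 1. *)
Lemma theta_d1_neg (s : R) : 0 < s -> theta_d1 s < 0.
Proof.
  intros Hs. assert (P := PI_RGT_0).
  assert (Q := exp_pos (- PI * s)).
  assert (H : 1 <= PSeries (PS_derive square_coeff) (exp (- PI * s))).
  { replace 1 with (PS_derive square_coeff 0) by (unfold PS_derive; simpl; change (square_coeff 1) with 1; ring).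
    apply PSeries_ge_head.
    - apply PS_derive_nonneg. intros; apply square_coeff_bounds.
    - lra.
    - rewrite CV_radius_derive. apply square_coeff_radius, nome_bounds, Hs. }
  unfold theta_d1.
  assert (0 < exp (- PI * s) * PSeries (PS_derive square_coeff) (exp (- PI * s)))
    by (apply Rmult_lt_0_compat; lra).
  nra.
Qed.

(** * The inequality for [s >= 1] *)

Lemma nome_le_eighth (s : R) : 1 <= s -> exp (- PI * s) <= 1 / 8.
Proof.
  intros Hs.
  assert (P := PI2_3_2). unfold PI2 in P.
  (* [PI > 3] gives [q <= exp (-3)], and [exp 1 >= 2] gives [exp (-3) <= 1/8]. *)
  apply Rle_trans with (exp (Ropp 3)); [apply exp_le; nra|].
  rewrite exp_Ropp. unfold Rdiv. rewrite Rmult_1_l. apply Rinv_le_contravar; [lra|].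
  replace 3 with (INR 3 * 1) by (simpl; ring). rewrite <- exp_pow.
  replace 8 with (2 ^ 3) by ring. apply pow_incr.
  generalize (exp_ineq1_le 1). lra.
Qed.

(** With [t] the value of theta, [D = - theta' / PI] and [E = 2 q^2 P''(q)], the expression is
    [PI (s PI E t + D (s PI (t - D) - t))]. The [E] term is nonnegative, and [D] is small compared
    with [t >= 1]. *)
Lemma theta_log_convex_ge_1 (s : R) : 1 <= s ->
  0 < s * (theta_d2 s * theta3 s - theta_d1 s ^ 2) + theta_d1 s * theta3 s.
Proof.
  intros Hs. assert (s0 : 0 < s) by lra.
  assert (P := PI2_3_2). unfold PI2 in P.
  assert (N := theta_d1_neg s s0).
  assert (T := theta_series_ge_1 s s0). rewrite <- theta3_theta_series in T by exact s0.
  assert (Q := nome_le_eighth s Hs). assert (Q0 := exp_pos (- PI * s)).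
  assert (U := PSeries_derive_square_le (exp (- PI * s)) ltac:(lra)).
  assert (V : 0 <= PSeries (PS_derive (PS_derive square_coeff)) (exp (- PI * s))).
  { assert (C : forall n, 0 <= PS_derive (PS_derive square_coeff) n).
    { apply PS_derive_nonneg, PS_derive_nonneg. intros; apply square_coeff_bounds. }
    apply Rle_trans with (1 := C 0%nat).
    apply PSeries_ge_head; [exact C|lra|].
    rewrite !CV_radius_derive. apply square_coeff_radius, nome_bounds, s0. }
  unfold theta_d1, theta_d2 in *.
  set (q := exp (- PI * s)) in *. set (t := theta3 s) in *.
  set (A := PSeries (PS_derive square_coeff) q) in *.
  set (B := PSeries (PS_derive (PS_derive square_coeff)) q) in *.
  assert (U' : A <= 4 / 3).
  { apply Rle_trans with (1 := U). replace (4 / 3) with (/ (3 / 4)) by field.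
    apply Rinv_le_contravar; lra. }
  set (D := 2 * (q * A)).
  assert (D0 : 0 < D) by (unfold D; nra).
  (* [q <= 1/8] and [A <= 4/3] give [D = 2 q A <= 1/3]. *)
  assert (D1 : D <= 1 / 3) by (unfold D; nra).
  assert (E0 : 0 <= 2 * (q ^ 2 * B)) by (assert (0 <= q ^ 2) by nra; nra).
  set (E := 2 * (q ^ 2 * B)) in *.
  replace (s * (2 * PI ^ 2 * (q * A + q ^ 2 * B) * t - (- (2 * PI) * (q * A)) ^ 2) + - (2 * PI) * (q * A) * t)
    with (PI * (s * PI * (E * t) + D * (s * PI * (t - D) - t))) by (unfold D, E; ring).
  apply Rmult_lt_0_compat; [lra|].
  assert (SP : 3 <= s * PI) by nra.
  assert (0 <= s * PI * (E * t)) by (apply Rmult_le_pos; [|apply Rmult_le_pos]; lra).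
  (* Using [s PI >= 3] and [D <= 1/3], the left side is at least [3 t - 1 - t = 2 t - 1 > 0]. *)
  assert (0 < s * PI * (t - D) - t) by nra.
  assert (0 < D * (s * PI * (t - D) - t)) by (apply Rmult_lt_0_compat; lra).
  lra.
Qed.

(** * Transfer to [s < 1] *)

Lemma theta3_ge_1 (s : R) : 0 < s -> 1 <= theta3 s.
Proof. intros Hs. rewrite theta3_theta_series by exact Hs. now apply theta_series_ge_1. Qed.

Definition log_slope (s : R) : R := s * theta_d1 s / theta3 s.

(** The numerator is [s] times the difference of the two sides of the inequality to be proved, so
    the claim is that [log_slope] has positive derivative. *)
Lemma log_slope_derive (s : R) : 0 < s ->
  is_derive log_slope s
    ((s * (theta_d2 s * theta3 s - theta_d1 s ^ 2) + theta_d1 s * theta3 s) / theta3 s ^ 2).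
Proof.
  intros Hs. assert (T := theta3_ge_1 s Hs).
  unfold log_slope. evar_last.
  - apply is_derive_div.
    + apply (is_derive_mult (fun t => t) theta_d1);
        [apply is_derive_id|now apply theta_d1_derive|intros; apply Rmult_comm].
    + now apply theta3_derive.
    + lra.
  - unfold plus, mult, one; simpl. field. lra.
Qed.

(* Logarithmic derivative of the inversion formula. *)
Lemma log_slope_inversion (s : R) : 0 < s -> log_slope s = - (1 / 2) - log_slope (/ s).
Proof.
  intros Hs. assert (Hi : 0 < / s) by now apply Rinv_0_lt_compat.
  assert (T := theta3_ge_1 s Hs). assert (T' := theta3_ge_1 (/ s) Hi).
  assert (I : forall t, 0 < t -> t * theta3 t ^ 2 = theta3 (/ t) ^ 2).
  { intros t Ht. assert (0 < / t) by now apply Rinv_0_lt_compat.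
    rewrite !theta3_theta_series by assumption. now apply theta_series_inversion. }
  (* The same function is differentiated directly and, in [D2], through its inverted form;
     uniqueness of the derivative then relates [theta_d1 s] to [theta_d1 (/ s)]. *)
  assert (D1 : is_derive (fun t => t * theta3 t ^ 2) s
     (theta3 s ^ 2 + s * (2 * theta3 s * theta_d1 s))).
  { evar_last.
    - apply (is_derive_mult (fun t => t) (fun t => theta3 t ^ 2));
        [apply is_derive_id|apply is_derive_pow, theta3_derive, Hs|intros; apply Rmult_comm].
    - unfold plus, mult, one; simpl. ring. }
  assert (D2 : is_derive (fun t => t * theta3 t ^ 2) s
     (2 * theta3 (/ s) * (- / s ^ 2 * theta_d1 (/ s)))).
  { apply is_derive_ext_loc with (fun t => theta3 (/ t) ^ 2).
    - exists (mkposreal s Hs). intros t Ht.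
      apply Rabs_def2 in Ht. unfold minus, plus, opp in Ht; simpl in Ht.
      symmetry. apply I. lra.
    - evar_last.
      + apply is_derive_pow.
        apply (is_derive_comp theta3 (fun t => / t)); [now apply theta3_derive|].
        apply (is_derive_inv (fun t => t)); [apply is_derive_id|lra].
      + unfold scal, mult, one; simpl. unfold mult; simpl. field. lra. }
  apply is_derive_unique in D1. apply is_derive_unique in D2. rewrite D1 in D2.
  specialize (I s Hs). unfold log_slope.
  (* The factor [2 s theta3(s)^2] turns the left side into [s] times the derivative in [D1] minus
     [s theta3(s)^2], so that [D2] can be substituted. *)
  apply Rmult_eq_reg_r with (2 * (s * theta3 s ^ 2)); [|nra].
  replace (s * theta_d1 s / theta3 s * (2 * (s * theta3 s ^ 2)))
    with (s * (theta3 s ^ 2 + s * (2 * theta3 s * theta_d1 s)) - s * theta3 s ^ 2)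
    by (field; lra).
  rewrite D2.
  replace ((- (1 / 2) - / s * theta_d1 (/ s) / theta3 (/ s)) * (2 * (s * theta3 s ^ 2)))
    with (- (s * theta3 s ^ 2) - 2 * / s * theta_d1 (/ s) / theta3 (/ s) * (s * theta3 s ^ 2))
    by (field; lra).
  rewrite I at 2. rewrite I. field. lra.
Qed.

(** For [s < 1], differentiating [log_slope_inversion] gives [g'(s) = g'(1/s) / s^2] for
    [g = log_slope], and [1/s] falls under the case already treated. *)
Lemma theta_log_convex (s : R) : 0 < s ->
  0 < s * (theta_d2 s * theta3 s - theta_d1 s ^ 2) + theta_d1 s * theta3 s.
Proof.
  intros Hs. destruct (Rle_dec 1 s) as [H|H]; [now apply theta_log_convex_ge_1|].
  assert (Hi : 0 < / s) by now apply Rinv_0_lt_compat.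
  assert (H1 : 1 <= / s) by (rewrite <- Rinv_1; apply Rinv_le_contravar; lra).
  assert (T := theta3_ge_1 s Hs). assert (T' := theta3_ge_1 (/ s) Hi).
  assert (D1 := log_slope_derive s Hs). assert (D2 := log_slope_derive (/ s) Hi).
  assert (C := theta_log_convex_ge_1 (/ s) H1).
  set (X := s * _ + _) in *. set (Y := / s * _ + _) in *.
  assert (D3 : is_derive log_slope s (/ s ^ 2 * (Y / theta3 (/ s) ^ 2))).
  { apply is_derive_ext_loc with (fun t => - (1 / 2) - log_slope (/ t)).
    - exists (mkposreal s Hs). intros t Ht.
      apply Rabs_def2 in Ht. unfold minus, plus, opp in Ht; simpl in Ht.
      symmetry. apply log_slope_inversion. lra.
    - evar_last.
      + apply (is_derive_minus (fun _ => - (1 / 2)) (fun t => log_slope (/ t)));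
          [apply is_derive_const|].
        apply (is_derive_comp log_slope (fun t => / t)); [exact D2|].
        apply (is_derive_inv (fun t => t)); [apply is_derive_id|lra].
      + unfold minus, plus, opp, scal, zero, one; simpl. unfold mult; simpl. field. lra. }
  apply is_derive_unique in D1. apply is_derive_unique in D3. rewrite D1 in D3.
  replace X with (X / theta3 s ^ 2 * theta3 s ^ 2) by (field; lra).
  rewrite D3.
  apply Rmult_lt_0_compat; [|nra]. apply Rmult_lt_0_compat.
  - apply Rinv_0_lt_compat. nra.
  - apply Rdiv_lt_0_compat; [exact C|nra].
Qed.

(** On [s > 0] the values of [d1] and [d2] are forced by uniqueness of derivatives, so the
    existential form speaks of the true first and second derivatives of theta. *)
Theorem theorem3 :
  exists d1 d2 : R -> R,
    (forall s, 0 < s -> derivable_pt_lim theta3 s (d1 s)) /\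
    (forall s, 0 < s -> derivable_pt_lim d1 s (d2 s)) /\
    (forall s, 0 < s ->
       d2 s * theta3 s - (d1 s)^2 > - (d1 s * theta3 s) / s /\
       - (d1 s * theta3 s) / s > 0).
Proof.
  exists theta_d1, theta_d2. split; [|split].
  - intros s Hs. apply is_derive_Reals. now apply theta3_derive.
  - intros s Hs. apply is_derive_Reals. now apply theta_d1_derive.
  - intros s Hs. assert (C := theta_log_convex s Hs).
    assert (N := theta_d1_neg s Hs). assert (T := theta3_ge_1 s Hs).
    split.
    + apply Rlt_gt, (Rlt_div_l (- (theta_d1 s * theta3 s)) _ s); lra.
    + apply Rdiv_lt_0_compat; nra.
Qed.
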